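(* Let $\mathcal F$ be a hereditary saturated formation with $(1)\neq \mathcal F\neq \mathcal G$, and let $\pi\subseteq \pi(\mathcal F)$ be a non-empty set of primes. Then the equality $$Z_{\pi\mathcal F}(G)=\mathrm{Int}_{\mathcal F}(G)$$ holds for every finite group $G$ if and only if $\mathcal N\subseteq \mathcal F=\mathcal G_{\pi'}\mathcal F$ and $\mathcal F$ satisfies the $\pi$-boundary condition.
   Context: All groups are finite. $\mathcal G$ is the class of all finite groups, $\mathcal N$ the class of all nilpotent groups, $(1)$ the class of all identity groups. $\pi'$ is the complement of $\pi$ in the set $\mathbb P$ of all primes; $\mathcal G_{\pi'}$ is the class of all $\pi'$-groups, with $\mathcal G_{\varnothing}=(1)$. $\pi(\mathcal F)$ is the set of all primes dividing the order of some group in $\mathcal F$. Formations. For a class $\mathcal F$ containing the identity group, $G^{\mathcal F}$ is the intersection of all normal subgroups $N$ of $G$ with $G/N\in\mathcal F$. A formation is a class $\mathcal F$ of groups closed under homomorphic images and such that, if $\mathcal F\neq\varnothing$, $G/G^{\mathcal F}\in\mathcal F$ for every group $G$. It is saturated if $G\in\mathcal F$ whenever $G/\Phi(G)\in\mathcal F$, and hereditary if $H\le G\in\mathcal F$ implies $H\in\mathcal F$. For classes $\mathcal X,\mathcal F$, the product $\mathcal X\mathcal F$ is the class of all groups $G$ with $G^{\mathcal F}\in\mathcal X$. Canonical local satellite. For a function $f$ from primes to formations, $LF(f)$ is the class of all groups $G$ such that $G=1$ or $G/C_G(H/K)\in f(p)$ for every chief factor $H/K$ of $G$ and every prime $p$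 dividing $|H/K|$. Every non-empty saturated formation $\mathcal F$ has a unique function $F$ (its canonical local satellite) with $\mathcal F=LF(F)$ such that for every prime $p$: $F(p)\subseteq\mathcal F$, and $G\in F(p)$ whenever $G/O_p(G)\in F(p)$. Boundary condition. For a class $\mathcal Y$, a group is $\mathcal Y$-critical if it is not in $\mathcal Y$ but all its proper subgroups are. $\mathcal F$ satisfies the $\pi$-boundary condition if every group $G$ that is $F(p)$-critical for at least one $p\in\pi$ belongs to $\mathcal F$. Hypercentre. A chief factor $H/K$ of $G$ is $\mathcal F$-central in $G$ if $(H/K)\rtimes (G/C_G(H/K))\in\mathcal F$. $Z_{\pi\mathcal F}(G)$ is the product of all normal subgroups $N$ of $G$ such that either $N=1$ or every chief factor of $G$ below $N$ of order divisible by at least one prime in $\pi$ is $\mathcal F$-central in $G$. A subgroup $U$ of $G$ is $\mathcal F$-maximal in $G$ if $U\in\mathcal F$ and $U\le V\le G$, $V\in\mathcal F$ imply $U=V$. $\mathrm{Int}_{\mathcal F}(G)$ is the intersection of all $\mathcal F$-maximal subgroups of $G$. *)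

(* Defs.v *)
From mathcomp Require Import all_boot all_fingroup all_solvable.
From mathcomp Require Import boolp.

Set Implicit Arguments.
Unset Strict Implicit.
Unset Printing Implicit Defensive.

Import GroupScope.

(* Closure under isomorphism is not built in: for formations, the only abstract
   classes considered here, it follows from closure under homomorphic images. *)
Definition grp_class := forall gT : finGroupType, {group gT} -> Prop.

Definition subclass (X Y : grp_class) : Prop :=
  forall (gT : finGroupType) (G : {group gT}), X _ G -> Y _ G.

Definition eqclass (X Y : grp_class) : Prop :=
  forall (gT : finGroupType) (G : {group gT}), X _ G <-> Y _ G.

Definition all_groups : grp_class := fun gT G => True.

Definition identity_groups : grp_class := fun gT G => G :=: 1.

Definition nilpotent_groups : grp_class := fun gT G => nilpotent G.

Definition pi_groups (pi : nat_pred) : grp_class := fun gT G => pi.-group G.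

Definition class_primes (F : grp_class) (p : nat) : Prop :=
  prime p /\ exists (gT : finGroupType) (G : {group gT}), F _ G /\ p %| #|G|.

(* G^F; the index set contains G itself as soon as F contains the identity
   groups. *)
Definition residual (F : grp_class) (gT : finGroupType) (G : {group gT}) :
    {group gT} :=
  [group of \bigcap_(N : {group gT} | (N <| G) && `[< F _ (G / N)%G >]) N].

Definition class_prod (X F : grp_class) : grp_class :=
  fun gT G => X _ (residual F G).

(* The empty class is a formation. *)
Definition formation (F : grp_class) : Prop :=
  (forall (aT rT : finGroupType) (G : {group aT})
     (f : {morphism G >-> rT}),
     F _ G -> F _ (f @* G)%G) /\
  ((exists (gT : finGroupType) (G : {group gT}), F _ G) ->
   forall (gT : finGroupType) (G : {group gT}), F _ (G / residual F G)%G).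

Definition saturated (F : grp_class) : Prop :=
  forall (gT : finGroupType) (G : {group gT}), F _ (G / 'Phi(G))%G -> F _ G.

Definition hereditary (F : grp_class) : Prop :=
  forall (gT : finGroupType) (G H : {group gT}), H \subset G -> F _ G -> F _ H.

(* [chief_factor G K H] says that H / K is a chief factor of G, and
   ['C_G(H / K | 'Q)] is its centraliser C_G(H/K) in G. *)
Definition LF (f : nat -> grp_class) : grp_class := fun gT G =>
  G :=: 1 \/
  forall (H K : {group gT}) (p : nat),
    chief_factor G K H -> prime p -> p %| #|H / K| ->
    f p _ (G / 'C_G(H / K | 'Q))%G.

(* Values of f at non-primes are irrelevant. *)
Definition canonical_local_satellite (F : grp_class) (f : nat -> grp_class) :
    Prop :=
  [/\ forall p, prime p -> formation (f p),
      eqclass F (LF f),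
      forall p, prime p -> subclass (f p) F
    & forall p, prime p -> forall (gT : finGroupType) (G : {group gT}),
        f p _ (G / 'O_p(G))%G -> f p _ G].

Definition critical (Y : grp_class) : grp_class := fun gT G =>
  ~ Y _ G /\ forall H : {group gT}, H \proper G -> Y _ H.

(* f is meant to be the canonical local satellite of F. *)
Definition boundary_condition (pi : nat_pred) (F : grp_class)
    (f : nat -> grp_class) : Prop :=
  forall (gT : finGroupType) (G : {group gT}),
    (exists p, [/\ prime p, p \in pi & critical (f p) G]) -> F _ G.

Lemma chief_acts (gT : finGroupType) (G H K : {group gT}) :
  chief_factor G K H -> {acts G, on group H / K | 'Q}.
Proof.
case/andP=> /maxgroupp/andP[/proper_sub sKH nKG] /andP[sHG nHG].
split; first by apply: actsQ.
apply: morphimS; exact: subsetT.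
Qed.

(* G / C_G(H/K) acts on H / K through conjugation by coset representatives. *)
Definition chief_action (gT : finGroupType) (G H K : {group gT})
    (chG : chief_factor G K H) :=
  (<[chief_acts chG]> %% ('C_G(H / K | 'Q))%g)%act.

Lemma chief_is_groupAction (gT : finGroupType) (G H K : {group gT})
  (chG : chief_factor G K H) : is_groupAction (H / K) (chief_action chG).
Proof.
have [nHK sHKr] := chief_acts chG.
have defR: 'C_(|actby_groupAction (chief_acts chG))('C_G(H / K | 'Q)) = H / K.
  rewrite gacent_actby setIA setIid; apply/setIidPl.
  by rewrite gacentC ?subsetIr // subIset // (acts_dom nHK).
by have /= := @modact_is_groupAction _ _ _ _ (actby_groupAction (chief_acts chG))
  ('C_G(H / K | 'Q))%G; rewrite [X in is_groupAction X _]defR.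
Qed.

Definition chief_groupAction (gT : finGroupType) (G H K : {group gT})
    (chG : chief_factor G K H) :
    groupAction (G / 'C_G(H / K | 'Q)) (H / K) :=
  GroupAction (chief_is_groupAction chG).

Definition central (F : grp_class) (gT : finGroupType) (G H K : {group gT}) :
    Prop :=
  exists chG : chief_factor G K H,
    F _ [set: sdprod_by (chief_groupAction chG)]%G.

(* The big product of groups is the subgroup they generate, which is the set
   product here since the factors are normal in G. *)
Definition hypercentre (pi : nat_pred) (F : grp_class) (gT : finGroupType)
    (G : {group gT}) : {group gT} :=
  (\prod_(N : {group gT} | (N <| G) &&
     `[< N :=: 1%g \/
         forall H K : {group gT}, chief_factor G K H -> H \subset N ->
           (exists p, [/\ prime p, p \in pi & p %| #|(H / K)%g|]) ->
           central F G H K >]) N)%G.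

Definition F_maximal (F : grp_class) (gT : finGroupType) (G U : {group gT}) :
    Prop :=
  [/\ U \subset G, F _ U
    & forall V : {group gT}, U \subset V -> V \subset G -> F _ V -> U :=: V].

Definition Int (F : grp_class) (gT : finGroupType) (G : {group gT}) :
    {group gT} :=
  [group of \bigcap_(U : {group gT} | `[< F_maximal F G U >]) U].

(* Main.v *)
Require Import Defs.
From mathcomp Require Import all_boot all_fingroup all_solvable all_algebra
  all_character.
From mathcomp Require Import boolp.
Import GroupScope.

Set Implicit Arguments.
Unset Strict Implicit.
Unset Printing Implicit Defensive.

(** Write [f] for the canonical local satellite of [F]. The proof rests on three
    facts about it.

    First, [H / K] is F-central in [G] exactly when [G / C_G(H / K)] lies in
    [f p] for all primes [p] dividing the order of [H / K] ([centralP]). So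
    centrality is a property of the group of automorphisms induced on the
    factor, and the semidirect product of the definition can be forgotten.

    Second, extensions of groups in [F] are recognised by their action on the
    kernel ([satellite_normal_ext]); conversely, for a group in [F], the group
    induced on a characteristically simple normal subgroup of order divisible
    by [p] lies in [f p] ([satellite_charsimple]).

    Third, every group [G] acts faithfully on an elementary abelian p-group [P],
    the regular module, and [G] lies in [f p] if and only if the semidirect
    product [P G] lies in [F] ([satellite_sdprod], [satellite_complement]). This
    is how membership in [f p] becomes a statement about [F]; it shows that
    [f p] inherits heredity from [F] ([satellite_hereditary]).

    Suppose that [F] is closed under extensions of normal pi'-subgroups and
    satisfies the boundary condition. That the hypercentre lies in every
    F-maximal subgroup follows from the second fact by descending along a chief
    series ([hypercentre_sub_Int]). Conversely, let [H / K] be a chief factor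
    below the intersection of the F-maximal subgroups. If the group induced on
    it were not in [f p], then a minimal subgroup of it outside [f p] would be
    critical, hence in [F]; it is covered by a subgroup [M] in [F], and [H M] is
    in [F] as [H] lies in every F-maximal subgroup, so the second fact puts the
    critical group in [f p] ([Int_chief_satellite]). For the primes [q] outside
    [pi] there is nothing to show, because then [f q] is the whole of [F]
    ([satellite_pi']).

    Suppose now that the equality holds in all groups. Normal pi'-subgroups lie
    in the hypercentre trivially, which makes [F] closed under extensions by
    them ([Int_pi'_ext]); so [F] involves all primes and contains the nilpotent
    groups. For a critical group [G] outside [F], one applies the equality to
    [P G], in which [P] lies in every F-maximal subgroup because [G] is
    critical ([critical_boundary]). *)

(** * Formations and their residuals *)

Section Formations.

Variable F : grp_class.
Hypothesis formF : formation F.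

Lemma formation_homg (aT rT : finGroupType) (G : {group aT}) (H : {group rT}) :
  H \homg G -> F G -> F H.
Proof.
case/homgP=> f defH FG; have := formF.1 _ _ _ f FG.
by congr (F _); apply: group_inj.
Qed.

Lemma formation_isog (aT rT : finGroupType) (G : {group aT}) (H : {group rT}) :
  G \isog H -> F G -> F H.
Proof. by rewrite isog_sym => /isog_hom; apply: formation_homg. Qed.

Lemma formation_quotientS (gT : finGroupType) (G A B : {group gT}) :
  G \subset 'N(A) -> G \subset 'N(B) -> A \subset B ->
  F (G / A)%G -> F (G / B)%G.
Proof. by move=> nAG nBG sAB; apply: formation_homg; apply: homg_quotientS. Qed.

Lemma formation_quotient (gT : finGroupType) (G A : {group gT}) :
  G \subset 'N(A) -> F G -> F (G / A)%G.
Proof. by move=> nAG; apply: formation_homg; apply: quotient_homg. Qed.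

Lemma residual_sub (gT : finGroupType) (G N : {group gT}) :
  N <| G -> F (G / N)%G -> residual F G \subset N.
Proof. by move=> nNG FGN; apply: bigcap_inf; rewrite nNG; apply/asboolP. Qed.

Section Nonempty.

Hypothesis neF : exists (gT : finGroupType) (G : {group gT}), F G.

Lemma formation_trivial (gT : finGroupType) (G : {group gT}) : G :=: 1 -> F G.
Proof.
move=> G1; have [hT [H FH]] := neF; apply: formation_homg FH.
apply/homgP; exists (trivm H); rewrite G1.
by apply/trivgP; apply/subsetP=> _ /morphimP[x _ _ ->]; rewrite inE.
Qed.

Lemma residual_quotient (gT : finGroupType) (G : {group gT}) :
  F (G / residual F G)%G.
Proof. exact: formF.2 neF _ _. Qed.

Lemma residual_normal (gT : finGroupType) (G : {group gT}) :
  residual F G <| G.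
Proof.
apply/andP; split.
  by apply: residual_sub => //; apply: formation_trivial;
    rewrite /= trivg_quotient.
apply: norms_bigcap; apply/bigcapsP=> N /andP[/andP[_ nNG] _]; exact: nNG.
Qed.

End Nonempty.

(** Heredity applied to the section [H N / N] of [G / N], read inside [H]. *)
Lemma hereditary_section (gT : finGroupType) (G H N : {group gT}) :
  hereditary F -> H \subset G -> G \subset 'N(N) ->
  F (G / N)%G -> F (H / (H :&: N))%G.
Proof.
move=> hF sHG nNG FG; have nNH := subset_trans sHG nNG.
have /formation_isog : (H / N)%G \isog (H / (H :&: N))%G.
  by rewrite isog_sym /= setIC; apply: second_isog.
by apply; apply: hF FG; apply: quotientS.
Qed.

End Formations.

(** * Chief factors *)

Section ChiefFactors.

Variable gT : finGroupType.
Implicit Types G H K L M N R X : {group gT}.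

Lemma chief_factorP G K H :
  reflect [/\ K <| G, H <| G, K \proper H &
              forall M, M <| G -> K \subset M -> M \subset H ->
                M :=: K \/ M :=: H]
          (chief_factor G K H).
Proof.
apply: (iffP andP) => [[/maxgroupP[/andP[prKH nKG] maxK] nHG] | [nKG nHG prKH
  minH]].
  have [sHG _] := andP nHG; split=> //.
    by rewrite /normal nKG (subset_trans (proper_sub prKH)).
  move=> M /andP[sMG nMG] sKM sMH.
  have [eMH | prMH] := eqVproper sMH; first by right.
  by left; apply: maxK => //; rewrite prMH.
split=> //; apply/maxgroupP; split; first by rewrite prKH normal_norm.
move=> M /andP[prMH nMG] sKM.
have nM: M <| G.
  by rewrite /normal nMG (subset_trans (proper_sub prMH)) ?normal_sub.
have [//|eMH] := minH M nM sKM (proper_sub prMH).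
by rewrite eMH properxx in prMH.
Qed.

Lemma chief_factor_below G N :
  N <| G -> N :!=: 1 -> exists K, chief_factor G K N.
Proof.
move=> nNG ntN.
have [|K maxK _] := @maxgroup_exists _ (fun K =>
  (K \proper N) && (G \subset 'N(K))) 1%G.
  by rewrite proper1G ntN norms1.
by exists K; apply/andP.
Qed.

(** The centraliser of a section is handled through commutators from here on:
    the action on cosets lives on a type that depends on [K], which makes
    sections with different [K] awkward to compare directly. *)
Lemma sub_cent_section G H K (A : {set gT}) :
  K <| G -> H <| G -> A \subset G ->
  (A \subset 'C_G(H / K | 'Q)) = ([~: A, H] \subset K).
Proof.
move=> /andP[_ nKG] /andP[sHG _] sAG.
by rewrite subsetI sAG /= sub_astabQR ?(subset_trans _ nKG).
Qed.

Lemma cent_section_normal G H K :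
  K <| G -> H <| G -> 'C_G(H / K | 'Q) <| G.
Proof.
move=> /andP[_ nKG] /andP[_ nHG]; rewrite /normal subsetIl /= normsI ?normG //.
by apply: subset_trans (astab_norm _ _); apply: actsQ.
Qed.


(** If [H = K H1] and [K1] is the intersection of [K] and [H1], then [H / K] and
    [H1 / K1] are isomorphic as groups with operators in [G]. This and the next
    two lemmas record the consequences used below. The group [K1] is kept
    abstract so that a given group can take its place without rewriting inside
    types. *)
Lemma card_perspective G H K H1 K1 :
  K <| G -> H1 <| G -> H :=: K * H1 -> K1 :=: K :&: H1 -> #|H / K| = #|H1 / K1|.
Proof.
move=> /andP[_ nKG] /andP[sH1G _] -> /group_inj->; rewrite quotientMidl.
by apply/esym/card_isog/second_isog/(subset_trans sH1G).
Qed.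

(** The sections [H / K] and [H1 / K] are the same, and an element of [G] maps
    [H1] into [H1] under commutation, so that [K] may be replaced by its
    intersection with [H1]. *)
Lemma cent_perspective G H K H1 K1 :
  K <| G -> H1 <| G -> H :=: K * H1 -> K1 :=: K :&: H1 ->
  'C_G(H / K | 'Q) = 'C_G(H1 / K1 | 'Q).
Proof.
move=> nKG nH1G -> /group_inj->; rewrite quotientMidl.
have nKH1: K :&: H1 <| G by apply: normalI.
have eqC (A : {group gT}) : A \subset G ->
  (A \subset 'C_G(H1 / K | 'Q)) = (A \subset 'C_G(H1 / (K :&: H1) | 'Q)).
- move=> sAG; rewrite (sub_cent_section nKG) //
  (@sub_cent_section G H1 (K :&: H1)%G) //.
  by rewrite subsetI commg_subr (subset_trans sAG) ?andbT ?normal_norm.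
have := eqC 'C_G(H1 / K | 'Q)%G; have := eqC 'C_G(H1 / (K :&: H1) | 'Q)%G.
rewrite !subsetIl !subxx => /(_ isT) sCC /(_ isT) /esym sCC'.
by apply/eqP; rewrite eqEsubset sCC sCC'.
Qed.

Lemma chief_perspective G H K H1 K1 :
  K <| G -> H1 <| G -> H :=: K * H1 -> K1 :=: K :&: H1 ->
  chief_factor G K H = chief_factor G K1 H1.
Proof.
move=> nKG nH1G defH /group_inj->.
have nHG: H <| G by rewrite defH normalM.
have sKH: K \subset H by rewrite defH mulG_subl.
have sH1H: H1 \subset H by rewrite defH mulG_subr.
apply/chief_factorP/(chief_factorP _ (K :&: H1)%G) => [] [_ _ prK minH].
  split; rewrite ?normalI // ?properE ?subsetIr /=.
    rewrite subsetI subxx andbT; apply: contraL prK => sH1K.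
    by rewrite defH (mulGSid sH1K) properxx.
  move=> M nMG sKM sMH1.
  have nKM: M \subset 'N(K) by rewrite (subset_trans (normal_sub nMG))
    ?normal_norm.
  have eKM : K <*> M = K * M by rewrite norm_joinEr.
  have [|||eK|eH] := minH (K <*> M)%G; rewrite /= ?normalY ?joing_subl //.
  - by rewrite join_subG sKH (subset_trans sMH1).
  - left; apply/eqP; rewrite eqEsubset sKM subsetI sMH1 !andbT.
    by rewrite -eK joing_subr.
  right; apply/eqP; rewrite eqEsubset sMH1 -(mulSGid sKM) /= setIC group_modr
    //.
  by rewrite subsetI subxx -eKM eH.
split; rewrite // ?properE ?sKH /=.
  apply: contraL prK => sHK; rewrite /= (setIidPr (subset_trans sH1H sHK)).
  by rewrite properxx.
move=> M nMG sKM sMH.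
have defM: M :=: K * (M :&: H1).
  by rewrite setIC group_modl // -defH; apply/esym/setIidPr.
have [|||e|e] := minH (M :&: H1)%G; rewrite /= ?normalI ?setSI ?subsetIr //.
- by left; rewrite defM e mulGSid ?subsetIl.
by right; rewrite defM e defH.
Qed.

(** A chief factor [H / K] is either covered or avoided by a normal subgroup
    [R], since [K] times the intersection of [H] and [R] lies between [K] and
    [H]. In both cases [H / K] is perspective to another section, below [R] or
    above [R]. This replaces the theorem of Jordan and Hoelder throughout. *)
Lemma chief_cover_avoid G H K R :
  chief_factor G K H -> R <| G ->
  H :=: K * (H :&: R) \/
  (H <*> R = (K <*> R) * H /\ K = (K <*> R) :&: H :> {set gT}).
Proof.
case/chief_factorP=> nKG nHG prKH minH nRG; have sKH := proper_sub prKH.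
have nKR : R \subset 'N(K) by rewrite (subset_trans (normal_sub nRG))
  ?normal_norm.
have nHR : H \subset 'N(R) by rewrite (subset_trans (normal_sub nHG))
  ?normal_norm.
have nRH : H :&: R <| G by apply: normalI.
have eKJ : K <*> (H :&: R) = K * (H :&: R).
  by rewrite norm_joinEr // (subset_trans (subsetIr _ _) nKR).
have [||| eK | eH] := minH (K <*> (H :&: R))%G;
  rewrite /= ?normalY ?joing_subl //.
- by rewrite join_subG sKH subsetIl.
- right; have sRK : H :&: R \subset K by rewrite -eK joing_subr.
  rewrite norm_joinEl // norm_joinEr //; split.
    by rewrite -mulgA -(normC nHR) mulgA (mulSGid sKH).
  by rewrite -group_modl // [R :&: H]setIC mulGSid.
by left; rewrite -eKJ eH.
Qed.

End ChiefFactors.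

Section QuotientSections.

Variable gT : finGroupType.
Implicit Types G H K L M N R X : {group gT}.

Lemma chief_quotient G R H K :
  R <| G -> R \subset K -> chief_factor G K H ->
  chief_factor (G / R) (K / R) (H / R).
Proof.
move=> nRG sRK /chief_factorP[nKG nHG prK minH].
have sKH := proper_sub prK.
apply/(chief_factorP _ (K / R)%G (H / R)%G).
have nRK : R <| K := normalS sRK (normal_sub nKG) nRG.
have nRH : R <| H := normalS (subset_trans sRK sKH) (normal_sub nHG) nRG.
split; rewrite ?quotient_normal //=.
  by rewrite /proper quotientS //= quotientSGK ?proper_subn // normal_norm.
move=> Mb nMb sKM sMH.
have [M defM sRM nMG] := inv_quotientN nRG nMb.
have nRM : R <| M := normalS sRM (normal_sub nMG) nRG.
rewrite defM in sKM sMH *.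
rewrite quotientSGK ?normal_norm // in sKM.
rewrite quotientSGK ?normal_norm // in sMH; last exact: subset_trans sRK sKH.
by have [->|->] := minH M nMG sKM sMH; [left | right].
Qed.

Lemma cent_quotient G R H K :
  R <| G -> R \subset K -> K <| G -> H <| G ->
  'C_(G / R)((H / R) / (K / R) | 'Q) = 'C_G(H / K | 'Q) / R.
Proof.
move=> nRG sRK nKG nHG.
have nRK : R <| K := normalS sRK (normal_sub nKG) nRG.
have nKGb : (K / R <| G / R) by apply: quotient_normal.
have nHGb : (H / R <| G / R) by apply: quotient_normal.
have sCG : 'C_G(H / K | 'Q) \subset G by apply: subsetIl.
have [_ nG] := andP nRG; have [sHG _] := andP nHG.
have eqC (A : {group gT}) : A \subset G ->
    (A / R \subset 'C_(G / R)((H / R) / (K / R) | 'Q))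
    = (A \subset 'C_G(H / K | 'Q)).
  move=> sAG; rewrite (@sub_cent_section _ (G / R)%G (H / R)%G (K / R)%G)
    ?quotientS //.
  rewrite sub_cent_section // -quotientR ?(subset_trans _ nG) // quotientSGK //.
  by rewrite (subset_trans _ nG) // (subset_trans (commgSS sAG sHG)) //
    der1_subG.
apply/eqP; rewrite eqEsubset; apply/andP; split; last by rewrite eqC.
have nCb : ('C_(G / R)((H / R) / (K / R) | 'Q) <| G / R).
  exact: (@cent_section_normal _ (G / R)%G (H / R)%G (K / R)%G).
have [A defA sRA nAG] := @inv_quotientN _ _ _ 'C_(G / R)((H / R) / (K / R) |
  'Q)%G nRG nCb.
have sCA := subxx (A / R); rewrite -{1}defA in sCA.
by apply: subset_trans sCA _; rewrite quotientS // -eqC ?normal_sub // -defA.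
Qed.

Lemma cent_section_quotient G H K :
  K <| G -> 'C_(G / K)(H / K) = 'C_G(H / K | 'Q) / K.
Proof. by move=> /andP[sKG _]; rewrite quotientGI // quotient_astabQ. Qed.

Lemma sub_cent_section_refl G H K :
  K <| G -> H <| G -> K \subset 'C_G(H / K | 'Q).
Proof.
move=> nKG nHG; have sKG := normal_sub nKG;
  rewrite sub_cent_section // commg_subl.
by rewrite (subset_trans (normal_sub nHG)) ?normal_norm.
Qed.

Lemma quotient_cent_section_isog G H K :
  K <| G -> H <| G ->
  (G / K) / 'C_(G / K)(H / K) \isog G / 'C_G(H / K | 'Q).
Proof.
move=> nKG nHG; rewrite cent_section_quotient //.
by apply: third_isog; rewrite ?cent_section_normal ?sub_cent_section_refl.
Qed.

Lemma cent_quotient_isog G R H K :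
  R <| G -> R \subset K -> K <| G -> H <| G ->
  (G / R) / 'C_(G / R)((H / R) / (K / R) | 'Q) \isog G / 'C_G(H / K | 'Q).
Proof.
move=> nRG sRK nKG nHG; rewrite cent_quotient //.
apply: third_isog; rewrite ?cent_section_normal //.
exact: subset_trans sRK (sub_cent_section_refl nKG nHG).
Qed.

End QuotientSections.

(** * Minimal supplements and saturation *)

Section Supplements.

Variable gT : finGroupType.
Implicit Types G L N : {group gT}.

(** A maximal subgroup [M] of [L] not containing the intersection of [L] and
    [N] would supplement that intersection in [L], and hence [N] in [G], against
    the minimality of [L]. *)
Lemma minimal_supplement G N :
  N <| G ->
  exists L : {group gT},
    [/\ L \subset G, N * L = G & N :&: L \subset 'Phi(L)].
Proof.
move=> nNG; have [sNG nG] := andP nNG.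
have [|L minL _] := @mingroup_exists _ (fun L =>
  (L \subset G) && (N * L == G)) G.
  by rewrite subxx mulSGid // eqxx.
have /andP[sLG /eqP defG] := mingroupp minL; exists L; split=> //.
apply/bigcapsP=> M /predU1P[-> | maxM]; first exact: subsetIr.
have [sML nML] := andP (maxgroupp maxM).
apply: contraR nML => nsM.
have nML : M \subset 'N(N :&: L).
  by rewrite normsI ?(subset_trans sML) ?normG // (subset_trans sLG).
have defL : (N :&: L) * M = L.
  rewrite -norm_joinEr //; apply/eqP; rewrite eqEproper.
  rewrite join_subG subsetIr sML; apply: contra nsM => prJ.
  have [_ maxM'] := maxgroupP maxM.
  by rewrite -(maxM' ((N :&: L) <*> M)%G prJ) ?joing_subl ?joing_subr.
have [_ minL'] := mingroupP minL.
have -> // : M :=: L.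
apply: minL' => //; rewrite (subset_trans sML sLG) /=.
by rewrite -[X in _ == X]defG -[in X in _ == X]defL mulgA (mulGSid (subsetIl N
  L)).
Qed.

(** For a minimal supplement [L] of [N] the intersection of [L] and [N] is
    contained in the Frattini subgroup of [L], so [L] modulo its Frattini
    subgroup is an image of [G / N]. *)
Lemma saturated_supplement F G N :
  formation F -> saturated F -> N <| G -> F _ (G / N)%G ->
  exists L : {group gT}, [/\ L \subset G, N * L = G & F _ L].
Proof.
move=> formF satF nNG FGN.
have [L [sLG defG sNLPhi]] := minimal_supplement nNG.
exists L; split=> //; apply: satF.
have nNL : L \subset 'N(N) by rewrite (subset_trans sLG) ?normal_norm.
have nNLL : N :&: L <| L by rewrite setIC (normalGI sLG nNG).
apply: (formation_quotientS formF (A := (N :&: L)%G)) => //.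
- by rewrite normal_norm.
- by rewrite normal_norm ?Phi_normal.
apply: formation_isog FGN => //=.
by rewrite -defG quotientMidl isog_sym second_isog.
Qed.

End Supplements.

(** * The canonical local satellite *)

Section Satellite.

Variables (F : grp_class) (f : nat -> grp_class).
Hypothesis formF : formation F.
Hypothesis canf : canonical_local_satellite F f.

Lemma satellite_formation p : prime p -> formation (f p).
Proof. by case: canf => formf _ _ _; apply: formf. Qed.

Lemma satellite_sub p : prime p -> subclass (f p) F.
Proof. by case: canf => _ _ subf _; apply: subf. Qed.

Lemma satellite_LF (gT : finGroupType) (G : {group gT}) : F G <-> LF f G.
Proof. by case: canf. Qed.

Lemma satellite_pgroup_ext p (gT : finGroupType) (G P : {group gT}) :
  prime p -> P <| G -> p.-group P -> f p (G / P)%G -> f p G.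
Proof.
move=> p_pr nPG pP fGP; case: canf => _ _ _ extf; apply: extf => //.
apply: (formation_quotientS (satellite_formation p_pr)) fGP.
- exact: normal_norm.
- by rewrite normal_norm ?pcore_normal.
exact: pcore_max.
Qed.

Lemma satellite_chief p (gT : finGroupType) (G H K : {group gT}) :
  F G -> chief_factor G K H -> prime p -> p %| #|H / K| ->
  f p (G / 'C_G(H / K | 'Q))%G.
Proof.
move=> /satellite_LF[G1 | fG] chH; last exact: fG.
case/chief_factorP: chH => _ /andP[sHG _] /andP[_ /negP[]].
by rewrite (subset_trans sHG) // G1 sub1G.
Qed.

(** A chief factor of [X] avoided by [R] comes from a chief factor of [X / R];
    one that is covered by [R] is centralised by [C_X(R)], and its order
    divides the order of [R]. *)
Lemma satellite_normal_ext (gT : finGroupType) (X R : {group gT}) :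
  R <| X -> F (X / R)%G ->
  (forall q, prime q -> q %| #|R| -> f q (X / 'C_X(R))%G) -> F X.
Proof.
move=> nRX FXR fR; apply/satellite_LF; right=> H K p chH p_pr p_dvd.
have [nKX nHX prKH _] := chief_factorP _ _ _ chH.
have nRH : H :&: R <| X by apply: normalI.
have [defH | [defHR defK]] := chief_cover_avoid chH nRX; last first.
(* Avoided by [R]: [H / K] is perspective to [H R / K R]. *)
- have nKRX : (K <*> R)%G <| X by rewrite normalY.
  have nHRX : (H <*> R)%G <| X by rewrite normalY.
  have sRKR : R \subset (K <*> R)%G by apply: joing_subr.
  have := @chief_perspective _ X (H <*> R)%G (K <*> R)%G H K nKRX nHX defHR
    defK.
  have := @cent_perspective _ X (H <*> R)%G (K <*> R)%G H K nKRX nHX defHR defK.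
  have := @card_perspective _ X (H <*> R)%G (K <*> R)%G H K nKRX nHX defHR defK.
  rewrite chH => oHR cHR chHR; rewrite -oHR in p_dvd.
  have chb := chief_quotient nRX sRKR chHR.
  have isoC := cent_quotient_isog nRX sRKR nKRX nHRX; rewrite /= cHR in isoC.
  apply: (formation_isog (satellite_formation p_pr) isoC).
  apply: (satellite_chief FXR chb p_pr).
  have sHRX := normal_sub nHRX.
  have nKRHR : (K <*> R)%G <| (H <*> R)%G.
    by apply: normalS nKRX; rewrite //= defHR mulG_subl.
  have nRHR : R <| (H <*> R)%G by apply: normalS nRX; rewrite //= joing_subr.
  by rewrite (card_isog (third_isog sRKR nRHR nKRHR)).
(* Covered by [R]. *)
have oHK := card_perspective nKX nRH defH (erefl _).
have nK1X : (K :&: (H :&: R))%G <| X by rewrite normalI.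
have cHK := @cent_perspective _ X H K _ (K :&: (H :&: R))%G nKX nRH defH
  (erefl _).
apply: (formation_quotientS (satellite_formation p_pr)) (fR p p_pr _).
- by rewrite normsI ?normG ?norms_cent ?normal_norm.
- by rewrite normal_norm ?cent_section_normal.
- rewrite /= cHK (@sub_cent_section _ X (H :&: R)%G (K :&: (H :&: R))%G)
  ?subsetIl //.
  apply: subset_trans (sub1G _); rewrite -(commG1P (subxx 'C(R))).
  by rewrite commgSS ?subsetIr.
rewrite oHK in p_dvd; apply: dvdn_trans p_dvd _.
by rewrite (dvdn_trans (dvdn_quotient _ _)) ?cardSg ?subsetIr.
Qed.

End Satellite.

(** * Action on a characteristically simple normal subgroup *)

Section MinimalNormal.

Variable gT : finGroupType.
Implicit Types G H K M N R X : {group gT}.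

Lemma chief_factor1_below X N :
  N <| X -> N :!=: 1 ->
  exists2 M : {group gT}, chief_factor X 1%G M & M \subset N.
Proof.
move=> nNX ntN.
have [|M minM sMN] := @mingroup_exists _ (fun M =>
  (M :!=: 1) && (X \subset 'N(M))) N.
  by rewrite ntN normal_norm.
exists M => //; have [/andP[ntM nMX] minM'] := mingroupP minM.
apply/chief_factorP; split; rewrite ?normal1 ?proper1G //.
  by rewrite /normal nMX (subset_trans sMN) ?normal_sub.
move=> L nLX _ sLM; have [-> | ntL] := eqVneq (L : {set gT}) 1; first by left.
by right; apply: minM'; rewrite // ntL normal_norm.
Qed.

(** Coprime action: if [K] is centralised by [A] and [A] acts trivially on
    [N / K], then the commutator of [N] and [A] consists of fixed points of [A],
    and is trivial when [N] is abelian. *)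
Lemma coprime_chief_stable_cent p X R (A : {group gT}) :
  R <| X -> abelian R -> p.-group R -> A \subset X -> p^'.-group A ->
  (forall H K, chief_factor X K H -> H \subset R ->
    A \subset 'C_X(H / K | 'Q)) ->
  A \subset 'C(R).
Proof.
move=> nRX abR pR sAX p'A stA.
suff cA n N : N <| X -> N \subset R -> #|N| <= n -> A \subset 'C(N).
  exact: (cA #|R|).
elim: n N => [|n IHn] N nNX sNR; first by rewrite leqNgt cardG_gt0.
move=> leNn; have [->|ntN] := eqVneq (N : {set gT}) 1; first exact: cents1.
have [K chN] := chief_factor_below nNX ntN.
have [nKX _ prKN _] := chief_factorP _ _ _ chN.
have sKN := proper_sub prKN.
have cAK : A \subset 'C(K).
  apply: IHn => //; first exact: subset_trans sNR.
  by rewrite -ltnS (leq_trans (proper_card prKN)).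
have := stA _ _ chN sNR; rewrite sub_cent_section // commGC => sNAK.
have nNA : A \subset 'N(N) by rewrite (subset_trans sAX) ?normal_norm.
have pN := pgroupS sNR pR.
have cRA := coprime_abel_cent_TI nNA (pnat_coprime pN p'A) (abelianS sNR abR).
rewrite centsC; apply/commG1P; rewrite -cRA; apply/esym/setIidPl.
by rewrite (subset_trans sNAK) // centsC.
Qed.

End MinimalNormal.

Section SatelliteCharsimple.

Variables (F : grp_class) (f : nat -> grp_class).
Hypothesis formF : formation F.
Hypothesis canf : canonical_local_satellite F f.

Lemma satellite_section_ext (gT : finGroupType) (X H K : {group gT}) :
  K <| X -> H <| X -> K \subset H -> F (X / H)%G ->
  (forall q, prime q -> q %| #|H / K| -> f q (X / 'C_X(H / K | 'Q))%G) ->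
  F (X / K)%G.
Proof.
move=> nKX nHX sKH FXH fHK.
have nHK : (H / K)%G <| (X / K)%G by apply: quotient_normal.
apply: (satellite_normal_ext canf nHK) => [|q q_pr q_dvd].
  by apply: formation_isog FXH => //; rewrite isog_sym; apply: third_isog.
apply: formation_isog (fHK q q_pr q_dvd);
  first exact: (satellite_formation canf q_pr).
by rewrite isog_sym; apply: quotient_cent_section_isog.
Qed.

(** The satellite controls the action on a whole characteristically simple
    normal subgroup [R], although [R] may split into many chief factors of [X].
    Let [D] be the residual of [X] for [f p]; it centralises all the chief
    factors in question. If [R] is an elementary abelian p-group, then [D] acts
    on it as a p-group by coprime action, and [f p] absorbs normal p-subgroups.
    Otherwise [R] has no nontrivial normal subgroup that is nilpotent or of
    order prime to [p], and [D] meets [R] trivially: a minimal normal subgroup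
    of [X] in the intersection would be centralised by [D], hence abelian. So
    [D] centralises [R]. *)
Lemma satellite_charsimple p (gT : finGroupType) (X R : {group gT}) :
  prime p -> R <| X -> charsimple R -> p %| #|R| ->
  (forall H K : {group gT}, chief_factor X K H -> H \subset R ->
     p %| #|H / K| ->
     f p (X / 'C_X(H / K | 'Q))%G) ->
  f p (X / 'C_X(R))%G.
Proof.
move=> p_pr nRX chR p_dvd fR; have formp := satellite_formation canf p_pr.
have [ntR simR] := charsimpleP _ chR; have [sRX nRXn] := andP nRX.
have Op'1 : 'O_p^'(R) = 1.
  apply/eqP/contraT=> nt; have eR := simR _ nt (pcore_char _ _).
  have := pcore_pgroup p^' R; rewrite eR => /pgroupP/(_ p p_pr p_dvd).
  by rewrite !inE eqxx.
have chief1 (N : {group gT}) : N <| X -> N \subset R -> N :!=: 1 ->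
    exists M : {group gT},
      [/\ chief_factor X 1%G M, M \subset N & p %| #|M / 1|].
  move=> nNX sNR ntN; have [M chM sMN] := chief_factor1_below nNX ntN.
  have [_ nMX prM _] := chief_factorP _ _ _ chM; exists M; split=> //.
  rewrite -(card_isog (quotient1_isog M)).
  apply: contraLR prM; rewrite -p'natE // proper1G negbK -subG1 -Op'1 => p'M.
  by rewrite pcore_max // (normalS _ sRX nMX) // (subset_trans sMN).
have nef : exists (gT : finGroupType) (G : {group gT}), f p G.
  have [M [chM sMR pM]] := chief1 R nRX (subxx R) ntR.
  by eexists; eexists; apply: fR chM sMR pM.
pose D := residual (f p) X.
have fD : f p (X / D)%G by apply: residual_quotient.
have nDX : D <| X by apply: residual_normal.
have stD (H K : {group gT}) : chief_factor X K H -> H \subset R ->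
  p %| #|H / K| ->
    D \subset 'C_X(H / K | 'Q).
  move=> chH sHR pH; apply: residual_sub => //=; last exact: fR.
  by have [? ? _ _] := chief_factorP _ _ _ chH; apply: cent_section_normal.
have nCX : 'C_X(R) <| X by rewrite /normal subsetIl normsI ?normG ?norms_cent.
have [solR | nsolR] := boolP (solvable R).
- have [q q_pr abelR] := is_abelemP (charsimple_solvable chR solR).
  have pR : p.-group R.
    have qR := abelem_pgroup abelR.
    by have /eqP-> : p == q;
      rewrite // -[_ == _]/(p \in (q : nat_pred)) (pgroupP qR).
  have abR := abelem_abelian abelR.
  set C := 'C_X(R)%G in nCX *.
  have sDX := normal_sub nDX; have nCD := subset_trans sDX (normal_norm nCX).
  have nCDX : (C <*> D)%G <| X by rewrite normalY.
  have pDC : p.-group (D / C).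
    apply/pgroupP=> r r_pr r_dvd; apply: contraLR r_dvd => r'p.
    have [Q sylQ] := Sylow_exists r D.
    (* A Sylow r-subgroup [Q] of [D] with [r] not [p] centralises [R]. *)
    have sQC : Q \subset C.
      have [sQD rQ _] := and3P sylQ; rewrite subsetI (subset_trans sQD) //=.
      apply: (coprime_chief_stable_cent (p := p) nRX) => //.
      - exact: subset_trans sDX.
      - by apply: sub_in_pnat rQ => t _; rewrite !inE => /eqP->.
      move=> H K chH sHR; apply: subset_trans sQD (stD _ _ chH sHR _).
      have [nKX nHX prKH _] := chief_factorP _ _ _ chH.
      have pHK : p.-group (H / K) by rewrite quotient_pgroup // (pgroupS sHR).
      have [|//] := pgroup_pdiv pHK; rewrite -subG1 quotient_sub1.
        by case/andP: prKH.
      by rewrite (subset_trans (normal_sub nHX)) ?normal_norm.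
    have sylQC := quotient_pHall (subset_trans (pHall_sub sylQ) nCD) sylQ.
    rewrite -p'natE // -partn_eq1 ?cardG_gt0 // -(card_Hall sylQC).
    by rewrite /= (quotientS1 sQC) cards1.
  have nDCX : ((C <*> D) / C)%G <| (X / C)%G by apply: quotient_normal.
  apply: (satellite_pgroup_ext canf p_pr nDCX);
    first by rewrite /= quotientYidl.
  apply: formation_isog (formation_quotientS _ (normal_norm nDX) (normal_norm
    nCDX) (joing_subr _ _) fD) => //.
  by rewrite isog_sym third_isog // joing_subl.
have Fit1 : 'F(R) = 1.
  apply/eqP/contraT=> nt; have eR := simR _ nt (Fitting_char _).
  by have := Fitting_nil R; rewrite eR => /nilpotent_sol; rewrite (negPf nsolR).
apply: formation_quotientS fD; rewrite ?normal_norm //= subsetI normal_sub //=.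
apply/commG1P/trivgP; apply: (@subset_trans _ _ (D :&: R)).
  by rewrite commg_subI //
    subsetI subxx ?(subset_trans sRX) ?(subset_trans (normal_sub nDX))
    ?normal_norm.
have [-> //|ntDR] := eqVneq (D :&: R) 1.
have [|M [chM sM pM]] := chief1 (D :&: R)%G _ (subsetIr _ _) ntDR.
  exact: normalI.
have [sMD sMR] := subsetIP sM; have := stD _ _ chM sMR pM.
have [n1X nMX prM _] := chief_factorP _ _ _ chM.
rewrite sub_cent_section // ?(normal_sub nDX) // => /trivgP/commG1P cDM.
case/negP: (proper_subn prM); apply: subset_trans (_ : _ \subset 'F(R)) _.
  rewrite Fitting_max //.
    by rewrite (normalS _ sRX).
  by rewrite abelian_nil // /abelian (subset_trans sMD).
by rewrite Fit1.
Qed.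

End SatelliteCharsimple.

(** * Extensions by the regular module, and heredity of the satellite *)

Section RegularModule.

(** The semidirect product of the regular module over the field with [p]
    elements by [G]; this is the wreath product of a cyclic group of order [p]
    by [G]. What matters is a faithful action on an elementary abelian group
    for every [G] and every [p]: an irreducible one need not exist. *)
Lemma regular_module_sdprod p (gT : finGroupType) (G : {group gT}) :
  prime p ->
  exists (wT : finGroupType) (P Q W : {group wT}),
    [/\ P ><| Q = W, G \isog Q, p.-abelem P, P :!=: 1 & 'C_Q(P) = 1].
Proof.
move=> p_pr; pose to := mx_repr_groupAction (regular_repr 'F_p G).
exists (sdprod_by to), (sdpair1 to @* setT)%G, (sdpair2 to @* G)%G,
  [set: sdprod_by to]%G.
have inj1 := injm_sdpair1 to; have inj2 := injm_sdpair2 to.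
split=> /=.
- exact: sdprod_sdpair.
- exact: sub_isog.
- by rewrite injm_abelem // mx_Fp_abelem.
- rewrite morphim_injm_eq1 //; apply/trivgPn; exists (const_mx 1%R);
  rewrite ?inE //.
  apply/eqP=> /rowP/(_ (Ordinal (cardG_gt0 G)))/eqP.
  by rewrite !mxE GRing.oner_eq0.
apply/trivgP/subsetP=> y /setIP[/morphimP[a Ga _ ->] cPa].
(* An element that centralises the module fixes all its vectors. *)
have fixa (u : 'rV['F_p]_(gcard G)) : (u *m regular_repr 'F_p G a)%R = u.
  rewrite -mx_repr_actE //; apply: (injmP inj1); rewrite ?inE //.
  apply: etrans (sdpair_act to (in_setT u) Ga) _;
    rewrite conjgE -(centP cPa) ?mem_morphim ?inE //.
  by rewrite mulKg.
have /(subsetP (regular_mx_faithful 'F_p G)) : a \in rker (regular_repr 'F_p G).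
  apply/rkerP; split=> //; apply/row_matrixP=> i.
  by rewrite rowE fixa row1.
by move/set1P->; rewrite morph1 inE.
Qed.

End RegularModule.

Section SatelliteHereditary.

Variables (F : grp_class) (f : nat -> grp_class).
Hypothesis formF : formation F.
Hypothesis herF : hereditary F.
Hypothesis canf : canonical_local_satellite F f.

(** [f p] absorbs the normal p-subgroup [P]. With the next lemma, this reads
    membership of [G] in [f p] off the semidirect product [P Q], when [P] is a
    faithful module for [Q]. *)
Lemma satellite_sdprod p (gT wT : finGroupType) (G : {group gT})
    (P Q W : {group wT}) :
  prime p -> P ><| Q = W -> p.-group P -> G \isog Q -> f p G -> f p W.
Proof.
move=> p_pr defW pP isoGQ fG; have [nPW _ _ _ _] := sdprod_context defW.
apply: (satellite_pgroup_ext canf p_pr nPW pP).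
apply: formation_isog fG; first exact: (satellite_formation canf p_pr).
by apply: isog_trans isoGQ _; apply: sdprod_isog.
Qed.

(** As [P] is its own centraliser in [P Q], the action on [P] has image [Q]. *)
Lemma satellite_complement p (wT : finGroupType) (P Q W : {group wT}) :
  prime p -> P ><| Q = W -> p.-abelem P -> P :!=: 1 -> 'C_Q(P) = 1 ->
  (forall H K : {group wT}, chief_factor W K H -> H \subset P ->
     p %| #|H / K| -> f p (W / 'C_W(H / K | 'Q))%G) ->
  f p Q.
Proof.
move=> p_pr defW abelP ntP cQP fW;
  have [nPW sQW defPQ nPQ tiPQ] := sdprod_context defW.
have [pP cPP _] := and3P abelP.
have p_dvd : p %| #|P| by have [] := pgroup_pdiv pP ntP.
have := satellite_charsimple canf p_pr nPW (abelem_charsimple abelP ntP) p_dvd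
  fW.
have defC : 'C_W(P) = P.
  by rewrite -defPQ -group_modl // cQP mulg1.
have -> : (W :&: 'C(P))%G = P by apply: group_inj.
apply: formation_isog; first exact: (satellite_formation canf p_pr).
by rewrite isog_sym; apply: sdprod_isog.
Qed.

(** If [P] is a faithful module for [G] in [f p], then [P G] is in [F], and so
    is its subgroup [P H]; the action of [P H] on [P] then puts [H] in [f p]. *)
Lemma satellite_hereditary p : prime p -> hereditary (f p).
Proof.
move=> p_pr gT G H sHG fG; have formp := satellite_formation canf p_pr.
have [wT [P [Q [W [defW isoGQ abelP ntP cQP]]]]] := regular_module_sdprod G
  p_pr.
have [pP _ _] := and3P abelP; have [_ _ _ nPQ tiPQ] := sdprod_context defW.
have FW := satellite_sub canf p_pr (satellite_sdprod p_pr defW pP isoGQ fG).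
have [g injg defQ] := isogP isoGQ.
pose Q1 := (g @* H)%G.
have sQ1Q : Q1 \subset Q by rewrite -defQ morphimS.
have defW1 : P ><| Q1 = (P <*> Q1)%G.
  rewrite sdprodEY //=; first exact: subset_trans nPQ.
  by apply/trivgP; rewrite -tiPQ setIS.
have FW1 : F (P <*> Q1)%G.
  apply: herF FW; rewrite join_subG.
  have [/andP[sPW _] sQW _ _ _] := sdprod_context defW.
  by rewrite sPW (subset_trans sQ1Q).
have : f p Q1.
  apply: (satellite_complement p_pr defW1 abelP ntP).
    by apply/trivgP; rewrite -cQP setSI.
  by move=> H1 K1 chH1 _; apply: (satellite_chief canf).
by apply: formation_isog => //; rewrite isog_sym; apply: sub_isog.
Qed.

End SatelliteHereditary.

(** * Central chief factors *)

Lemma injm_charsimple (aT rT : finGroupType) (G : {group aT})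
    (g : {morphism G >-> rT}) :
  'injm g -> charsimple G -> charsimple (g @* G).
Proof.
move=> injg /charsimpleP[ntG simG]; apply/charsimpleP; split=> [|K ntK chK].
  by rewrite morphim_injm_eq1.
have sKG := char_sub chK.
have chK' : invm injg @* K \char G.
  by have := injm_char (injm_invm injg) (subxx _) chK; rewrite im_invm.
have := simG (invm injg @* K)%G _ chK';
  rewrite /= morphim_injm_eq1 ?injm_invm //.
move/(_ ntK)=> defG; apply: etrans (esym (morphpreK sKG)) _.
by rewrite -(morphim_invmE injg) defG.
Qed.

Section ChiefSemidirect.

Variables (gT : finGroupType) (G H K : {group gT}).
Hypothesis chG : chief_factor G K H.

Let nKG : K <| G. Proof. by case/chief_factorP: chG. Qed.
Let nHG : H <| G. Proof. by case/chief_factorP: chG. Qed.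
Local Notation C := 'C_G(H / K | 'Q).
Let nCG : C <| G. Proof. exact: cent_section_normal. Qed.

Lemma chief_actionE x g :
  x \in H / K -> g \in G -> chief_action chG x (coset C g) = x ^ coset K g.
Proof.
move=> HKx Gg; have Ng : g \in 'N(K) by rewrite (subsetP (normal_norm nKG)).
have actQ y a : y \in H / K -> a \in G -> ('Q%act y a = y ^ coset K a).
  case/morphimP=> h Nh _ -> Ga.
  have Na : a \in 'N(K) by rewrite (subsetP (normal_norm nKG)).
  by rewrite /= qactE ?qact_domE ?subsetT ?astabsJ //= conjgE -morphJ.
have fixx : x \in 'Fix_<[chief_acts chG]>(G :&: C).
  rewrite afix_actby inE; apply/orP; right;
    apply/afixP=> c /setIP[_ /setIP[_ /setIP[_ cc]]].
  exact: (astab_act cc).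
have NCg : g \in 'N(C) by rewrite (subsetP (normal_norm nCG)).
apply: etrans (modactE Gg NCg fixx) _.
by rewrite actbyE ?actQ.
Qed.

Local Notation to := (chief_groupAction chG).
Local Notation S := [set: sdprod_by to]%G.
Local Notation R1 := (sdpair1 to @* (H / K))%G.
Local Notation Q1 := (sdpair2 to @* (G / C))%G.

Lemma chief_sdprod_conj x g :
  x \in H / K -> g \in G ->
  sdpair1 to x ^ sdpair2 to (coset C g) = sdpair1 to (x ^ coset K g).
Proof.
move=> HKx Gg; rewrite -chief_actionE //.
by apply/esym/(sdpair_act to) => //; apply: mem_quotient.
Qed.

Lemma chief_sdprod_faithful : 'C_Q1(R1) = 1.
Proof.
apply/trivgP/subsetP=> y /setIP[/morphimP[a GCa /morphimP[g Ng Gg ->] ->] cg].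
suff /coset_id e : g \in C by rewrite /= e morph1 inE.
rewrite -sub1set sub_cent_section ?sub1set //.
have NKg : g \in 'N(K) by rewrite (subsetP (normal_norm nKG)).
rewrite -sub_astabQR ?sub1set //; last first.
  by rewrite (subset_trans (normal_sub nHG)) ?normal_norm.
rewrite astabQ inE NKg inE /=; apply/centP=> x HKx.
apply/esym/commgP/conjg_fixP/(injmP (injm_sdpair1 to)) => //=.
  by rewrite memJ_norm // (subsetP (quotient_norm _ _)) // mem_quotient //
    (subsetP (normal_norm nHG)).
rewrite -chief_sdprod_conj // conjgE -(centP cg) ?mem_morphim //.
by rewrite mulKg.
Qed.

(** An element [h] of [H] acts on [H / K] by conjugation, both as an element of
    the kernel of the semidirect product and through its image in [G / C]; the
    quotient of the two centralises [H / K]. Hence the semidirect product and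
    its complement induce the same automorphisms of [H / K]. *)
Lemma chief_sdprod_cent_cover : S \subset Q1 * 'C_S(R1).
Proof.
(* [sdpair1 h = sdpair2 h * (sdpair2 h)^-1 * sdpair1 h] for [h] in [H]. *)
have sR1 : R1 \subset Q1 * 'C_S(R1).
  apply/subsetP=> _ /morphimP[_ _ /morphimP[h Nh Hh ->] ->] /=.
  have Gh : h \in G := subsetP (normal_sub nHG) h Hh.
  have Qh : sdpair2 to (coset C h) \in Q1 by rewrite mem_morphim ?mem_quotient.
  have Rh : sdpair1 to (coset K h) \in R1 by rewrite mem_morphim ?mem_quotient.
  rewrite -[sdpair1 to _](mulKVg (sdpair2 to (coset C h))) mem_mulg //.
  rewrite inE in_setT /=; apply/centP=> _ /morphimP[x HKx _ ->].
  apply/esym/commgP/conjg_fixP; rewrite conjgM.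
  have HKh := mem_quotient K Hh.
  have -> : sdpair1 to x ^ (sdpair2 to (coset C h))^-1 = sdpair1 to (x ^ (coset
    K h)^-1).
    apply: (canLR (conjgK _)); rewrite chief_sdprod_conj ?conjgKV //.
    by rewrite groupJ ?groupV.
  by rewrite -morphJ ?groupJ ?groupV // conjgKV.
apply: (@subset_trans _ _ (Q1 * R1)).
  by rewrite /= (normC (im_sdpair_norm to)) im_sdpair.
by rewrite (subset_trans (mulgS _ sR1)) // mulgA mulGid.
Qed.

Lemma chief_sdprod_charsimple : charsimple R1.
Proof.
have [maxK _] := andP chG.
have := maxnormal_charsimple nHG maxK.
exact: injm_charsimple (injm_sdpair1 to).
Qed.

End ChiefSemidirect.

Section Central.

Variables (F : grp_class) (f : nat -> grp_class).
Hypothesis formF : formation F.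
Hypothesis herF : hereditary F.
Hypothesis canf : canonical_local_satellite F f.

(** Centrality of [H / K] only depends on the group [G / C_G(H / K)] and on the
    primes dividing the order of [H / K]. The semidirect product [S] induces on
    its kernel, which is characteristically simple, the same automorphisms as
    [G / C_G(H / K)]. *)
Lemma centralP (gT : finGroupType) (G H K : {group gT}) :
  chief_factor G K H ->
  (central F G H K <->
   forall p, prime p -> p %| #|H / K| -> f p (G / 'C_G(H / K | 'Q))%G).
Proof.
move=> chG; pose to := chief_groupAction chG.
pose R1 := (sdpair1 to @* (H / K))%G; pose S := [set: sdprod_by to]%G.
pose Q1 := (sdpair2 to @* (G / 'C_G(H / K | 'Q)))%G.
have chR1 : charsimple R1 := chief_sdprod_charsimple chG.
have cQR : 'C_Q1(R1) = 1 := chief_sdprod_faithful chG.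
pose C1 := 'C_S(R1)%G.
have cover : S \subset Q1 * C1 := chief_sdprod_cent_cover chG.
have defS : R1 ><| Q1 = S := sdprod_sdpair to.
have oR1 : #|R1| = #|H / K| by rewrite card_injm ?injm_sdpair1.
have isoQ : (G / 'C_G(H / K | 'Q))%G \isog Q1 by rewrite sub_isog ?injm_sdpair2.
have [nR1S sQ1S defRQ nRQ tiRQ] := sdprod_context defS.
have nCS : C1 <| S.
  by rewrite /normal subsetIl normsI ?normG ?norms_cent ?normal_norm.
split=> [[chG' FS] p p_pr p_dvd | fC].
  (* [central] provides its own proof that [H / K] is a chief factor. *)
  rewrite (bool_irrelevance chG' chG) in FS.
  have formp := satellite_formation canf p_pr;
    have herp := satellite_hereditary herF canf p_pr.
  rewrite -oR1 in p_dvd.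
  have := satellite_charsimple canf p_pr nR1S chR1 p_dvd
            (fun H1 K1 ch1 _ => satellite_chief canf FS ch1 p_pr).
  move/(hereditary_section formp herp sQ1S (normal_norm nCS)).
  apply: formation_isog => //.
  have tiQC : Q1 :&: C1 :&: Q1 = 1.
    apply/trivgP/subsetP=> y /setIP[/setIP[Qy /setIP[_ Cy]] _].
    by rewrite -cQR inE Qy.
  rewrite isog_sym (isog_trans isoQ) // quotient_isog //.
  by rewrite normsI ?normG // (subset_trans sQ1S) ?normal_norm.
have ntR1 : R1 :!=: 1 by have /charsimpleP[] := chR1.
have [p p_pr p_dvd] : exists2 p, prime p & p %| #|R1|.
  by exists (pdiv #|R1|); rewrite ?pdiv_dvd ?pdiv_prime ?cardG_gt1.
exists chG; apply: (satellite_normal_ext canf nR1S).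
  apply: (formation_isog formF (isog_trans isoQ (sdprod_isog defS))).
  by apply: (satellite_sub canf p_pr); apply: fC; rewrite -?oR1.
move=> q q_pr q_dvd; have formq := satellite_formation canf q_pr.
have fQ1 : f q Q1 by apply: (formation_isog formq isoQ); apply: fC;
  rewrite -?oR1.
apply: (formation_homg formq) fQ1.
change (S / C1 \homg Q1); have <- : Q1 / C1 = S / C1.
  apply/eqP; rewrite eqEsubset quotientS //=.
  by have := quotientS C1 cover; rewrite quotientMidr.
by apply: quotient_homg; rewrite (subset_trans sQ1S) ?normal_norm.
Qed.

End Central.

(** * The hypercentre *)

Section Hypercentre.

Variables (F : grp_class) (f : nat -> grp_class) (pi : nat_pred).
Hypothesis formF : formation F.
Hypothesis herF : hereditary F.
Hypothesis canf : canonical_local_satellite F f.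

Lemma central_perspective (gT : finGroupType) (G H K H1 K1 : {group gT}) :
  K <| G -> H1 <| G -> H :=: K * H1 -> K1 :=: K :&: H1 ->
  chief_factor G K H -> central F G H1 K1 -> central F G H K.
Proof.
move=> nKG nH1G defH defK1 chH.
have chH1 : chief_factor G K1 H1 by rewrite -(chief_perspective nKG nH1G defH
  defK1).
move/(centralP formF herF canf chH1) => fC.
apply/(centralP formF herF canf chH)=> p p_pr.
rewrite (card_perspective nKG nH1G defH defK1) => /(fC p p_pr).
apply: formation_homg; first exact: (satellite_formation canf p_pr).
by rewrite /= (cent_perspective nKG nH1G defH defK1) homg_refl.
Qed.

Definition pi_central_below (gT : finGroupType) (G N : {group gT}) :=
  forall H K : {group gT}, chief_factor G K H -> H \subset N ->
    (exists p, [/\ prime p, p \in pi & p %| #|(H / K)%g|]) -> central F G H K.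

Lemma sub_hypercentre (gT : finGroupType) (G N : {group gT}) :
  N <| G -> pi_central_below G N -> N \subset hypercentre pi F G.
Proof.
move=> nNG cN; rewrite /hypercentre (bigD1 N) /= ?joing_subl //.
by rewrite nNG; apply/asboolP; right.
Qed.

(** A chief factor below the join is covered by [N1], or is perspective to
    [H N1 / K N1], which lies between [N1] and the join of [N1] and [N2] and is
    therefore perspective to a chief factor below [N2]. *)
Lemma pi_central_below_join (gT : finGroupType) (G N1 N2 : {group gT}) :
  N1 <| G -> N2 <| G -> pi_central_below G N1 -> pi_central_below G N2 ->
  pi_central_below G (N1 <*> N2)%G.
Proof.
move=> nN1 nN2 c1 c2 H K chH sH [p [p_pr pi_p p_dvd]].
have [nKG nHG prKH _] := chief_factorP _ _ _ chH.
have [defH | [defH defK]] := chief_cover_avoid chH nN1.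
  have nH1 : (H :&: N1)%G <| G by apply: normalI.
  have ch1 := chH; rewrite (@chief_perspective _ G H K _ (K :&: (H :&: N1))%G
    nKG nH1 defH) // in ch1.
  apply: (@central_perspective _ G H K _ (K :&: (H :&: N1))%G nKG nH1 defH) =>
    //.
  apply: c1 ch1 (subsetIr _ _) _; exists p; split=> //.
  by rewrite -(card_perspective nKG nH1 defH).
have nK2 : (K <*> N1)%G <| G by rewrite normalY.
have nH2 : (H <*> N1)%G <| G by rewrite normalY.
have ch2 : chief_factor G (K <*> N1)%G (H <*> N1)%G.
  by rewrite (chief_perspective nK2 nHG defH defK).
have nH3 : ((H <*> N1) :&: N2)%G <| G by apply: normalI.
have def3 : H <*> N1 = (K <*> N1) * ((H <*> N1) :&: N2).
  apply/eqP; rewrite eqEsubset mul_subG ?subsetIl ?andbT //=; last first.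
    by rewrite join_subG joing_subr (subset_trans (proper_sub prKH))
      ?joing_subl.
  have sH1 : H <*> N1 \subset N1 * N2.
    rewrite -norm_joinEr; first by rewrite join_subG sH joing_subl.
    by rewrite (subset_trans (normal_sub nN2)) ?normal_norm.
  rewrite -{1}(setIidPl sH1) setIC -group_modl ?joing_subr //.
  by rewrite setIC mulSg ?joing_subr.
have ch3 := ch2.
rewrite (@chief_perspective _ G (H <*> N1)%G (K <*> N1)%G _
  ((K <*> N1) :&: ((H <*> N1) :&: N2))%G nK2 nH3 def3) // in ch3.
suff: central F G (H <*> N1)%G (K <*> N1)%G.
  move/(centralP formF herF canf ch2) => fC;
    apply/(centralP formF herF canf chH)=> q q_pr.
  rewrite -(card_perspective nK2 nHG defH defK) => /(fC q q_pr).
  apply: formation_homg; first exact: (satellite_formation canf q_pr).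
  by rewrite /= -(cent_perspective nK2 nHG defH defK) homg_refl.
apply: (central_perspective nK2 nH3 def3 (erefl _) ch2).
apply: c2 ch3 (subsetIr _ _) _.
exists p; split=> //; rewrite -(card_perspective nK2 nH3 def3) //.
by rewrite (card_perspective nK2 nHG defH defK).
Qed.

(** The property of the generating subgroups passes to their product, by the
    previous lemma. *)
Lemma hypercentre_normal_central (gT : finGroupType) (G : {group gT}) :
  hypercentre pi F G <| G /\ pi_central_below G (hypercentre pi F G).
Proof.
rewrite /hypercentre; elim/big_ind: _ => [|N1 N2 [nN1 c1] [nN2 c2]|N].
- split=> [|H K chH]; first exact: normal1.
  have [_ _ prKH _] := chief_factorP _ _ _ chH => sH1.
  by case/negP: (proper_subn prKH); apply: subset_trans sH1 (sub1G K).
- by split; [apply: normalY | apply: pi_central_below_join].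
case/andP=> nNG /asboolP[N1 | cN]; split=> // H K chH.
have [_ _ prKH _] := chief_factorP _ _ _ chH => sHN.
by case/negP: (proper_subn prKH); apply: subset_trans sHN _; rewrite N1 sub1G.
Qed.

End Hypercentre.

(** * The intersection of the F-maximal subgroups *)

Section Intersection.

Variable F : grp_class.
Hypothesis formF : formation F.
Hypothesis herF : hereditary F.
Hypothesis neF : exists (gT : finGroupType) (G : {group gT}), F G.

Lemma F_maximal_exists (gT : finGroupType) (G U : {group gT}) :
  U \subset G -> F U -> exists2 V : {group gT}, F_maximal F G V & U \subset V.
Proof.
move=> sUG FU.
have [|V maxV sUV] := @maxgroup_exists _ (fun V =>
  (V \subset G) && `[< F V >]) U.
  by rewrite sUG; apply/asboolP.
have [/andP[sVG /asboolP FV] maxV'] := maxgroupP maxV.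
exists V => //; split=> // W sVW sWG FW; apply/esym/maxV' => //.
by rewrite sWG; apply/asboolP.
Qed.

Lemma Int_sub (gT : finGroupType) (G U : {group gT}) :
  F_maximal F G U -> Int F G \subset U.
Proof. by move=> maxU; apply: bigcap_inf; apply/asboolP. Qed.

Lemma sub_Int (gT : finGroupType) (G N : {group gT}) :
  (forall U : {group gT}, F_maximal F G U -> N \subset U) -> N \subset Int F G.
Proof. by move=> sN; apply/bigcapsP=> U /asboolP; apply: sN. Qed.

(** A subgroup [U] in [F] lies in some F-maximal subgroup, which contains [N]. *)
Lemma Int_join (gT : finGroupType) (G N U : {group gT}) :
  N \subset Int F G -> U \subset G -> F U -> F (N <*> U)%G.
Proof.
move=> sNI sUG FU; have [V maxV sUV] := F_maximal_exists sUG FU.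
have [sVG FV _] := maxV; apply: herF FV.
by rewrite join_subG sUV (subset_trans sNI) ?Int_sub.
Qed.

Lemma Int_normal (gT : finGroupType) (G : {group gT}) : Int F G <| G.
Proof.
have [V maxV _] := F_maximal_exists (sub1G G) (formation_trivial formF neF
  (erefl _)).
have [sVG _ _] := maxV.
rewrite /normal (subset_trans (Int_sub maxV)) //=.
apply/subsetP=> g Gg; rewrite inE.
apply: (@sub_Int _ G (Int F G :^ g)%G) => U [sUG FU maxU] /=.
rewrite sub_conjg; apply: (@Int_sub _ G (U :^ g^-1)%G).
have GVg : g^-1 \in G by rewrite groupV.
split=> [||W sUW sWG FW].
- by rewrite /= -(conjGid GVg) conjSg.
- by apply: (formation_isog formF) FU; apply: conj_isog.
apply: (@conjsg_inj _ g); rewrite /= conjsgKV.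
have -> : U :=: (W :^ g)%G; last by [].
apply: maxU => /=.
- by rewrite -sub_conjgV.
- by rewrite -(conjGid Gg) conjSg.
by apply: (formation_isog formF) FW; apply: conj_isog.
Qed.

End Intersection.

(** * The boundary condition forces the equality *)

Section Sufficiency.

Variables (F : grp_class) (f : nat -> grp_class) (pi : nat_pred).
Hypothesis formF : formation F.
Hypothesis satF : saturated F.
Hypothesis herF : hereditary F.
Hypothesis canf : canonical_local_satellite F f.
Hypothesis neF : exists (gT : finGroupType) (G : {group gT}), F G.

Lemma class_prod_pi'_ext :
  subclass (class_prod (pi_groups pi^') F) F ->
  forall (gT : finGroupType) (G N : {group gT}),
    N <| G -> pi^'.-group N -> F (G / N)%G -> F G.
Proof.
move=> extF gT G N nNG p'N FGN; apply: extF.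
by apply: pgroupS p'N; apply: residual_sub.
Qed.

Hypothesis pi'_ext : forall (gT : finGroupType) (G N : {group gT}),
  N <| G -> pi^'.-group N -> F (G / N)%G -> F G.

(** It is enough that [Z U] is in [F] for every F-maximal subgroup [U], where
    [Z] is the hypercentre. Descend
    along a chief series of [G] below [Z], from [Z U / Z], an image of [U], to
    [Z U]: a chief factor [M / K] whose order involves a prime in [pi] is
    central, and the satellite, being hereditary, contains the group that
    [Z U] induces on it; any other [M / K] is a normal pi'-subgroup. *)
Lemma hypercentre_sub_Int (gT : finGroupType) (G : {group gT}) :
  hypercentre pi F G \subset Int F G.
Proof.
set Z := hypercentre pi F G; apply: sub_Int => U [sUG FU maxU].
have [nZG cZ] := hypercentre_normal_central pi formF herF canf G.
rewrite -/Z in nZG cZ; set X := (Z <*> U)%G.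
have sXG : X \subset G by rewrite join_subG normal_sub.
have nZU : U \subset 'N(Z) by rewrite (subset_trans sUG) ?normal_norm.
suff FX : F X by rewrite (maxU X) ?joing_subl ?joing_subr.
have FXZ : F (X / Z)%G.
  apply: (formation_homg formF) FU; rewrite /= quotientYidl //.
  exact: quotient_homg.
have down n (M : {group gT}) : #|M| <= n -> M <| G -> M \subset Z ->
  F (X / M)%G -> F X.
  elim: n M => [|n IHn] M; first by rewrite leqNgt cardG_gt0.
  move=> leMn nMG sMZ FXM; have [M1 | ntM] := eqVneq (M : {set gT}) 1.
    apply: (formation_isog formF) FXM.
    by rewrite isog_sym quotient_isog ?M1 ?setIg1 ?norms1 ?(setIidPl (sub1G _)).
  have [K chM] := chief_factor_below nMG ntM.
  have [nKG _ prKM _] := chief_factorP _ _ _ chM; have sKM := proper_sub prKM.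
  apply: (IHn K) => //.
  - by rewrite -ltnS (leq_trans (proper_card prKM)).
  - exact: subset_trans sMZ.
  have sZX : Z \subset X by apply: joing_subl.
  have nKX : K <| X by rewrite (normalS _ sXG) //
    (subset_trans sKM) ?(subset_trans sMZ).
  have nMX : M <| X by rewrite (normalS _ sXG) // (subset_trans sMZ).
  have [pi_dvd | npi] := pselect (exists p, [/\ prime p, p \in pi & p %| #|(M /
    K)%g|]).
    have /(centralP formF herF canf chM) fM := cZ _ _ chM sMZ pi_dvd.
    apply: (satellite_section_ext formF canf nKX nMX sKM FXM) => q q_pr q_dvd.
    have formq := satellite_formation canf q_pr.
    have nCG : G \subset 'N('C_G(M / K | 'Q)) by rewrite normal_norm
      ?cent_section_normal.
    have := hereditary_section formq (satellite_hereditary herF canf q_pr) sXG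
      nCG (fM q q_pr q_dvd).
    apply: (formation_homg formq); rewrite /= setIA (setIidPl sXG).
    exact: homg_refl.
  apply: (pi'_ext (N := (M / K)%G)); first exact: quotient_normal.
    apply/pgroupP=> p p_pr p_dvd; rewrite inE /=; apply/negP=> pi_p.
    by apply: npi; exists p.
  apply: (formation_isog formF) FXM; rewrite isog_sym; exact: third_isog.
exact: (down #|Z| Z).
Qed.

(** The semidirect product of a faithful module in characteristic [q] by [Y] is
    in [F], since the module is a pi'-group, and its action on the module gives
    back [Y]. *)
Lemma satellite_pi' q (gT : finGroupType) (Y : {group gT}) :
  prime q -> q \notin pi -> F Y -> f q Y.
Proof.
move=> q_pr pi'q FY.
have [wT [P [Q [W [defW isoYQ abelP ntP cQP]]]]] := regular_module_sdprod Y
  q_pr.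
have [nPW _ _ _ _] := sdprod_context defW.
have [qP _ _] := and3P abelP.
have FW : F W.
  apply: (pi'_ext nPW).
    by apply: sub_in_pnat qP => r _; rewrite !inE => /eqP->.
  exact: (formation_isog formF (isog_trans isoYQ (sdprod_isog defW))).
have formq := satellite_formation canf q_pr.
apply: (formation_isog formq (_ : Q \isog Y)); first by rewrite isog_sym.
apply: (satellite_complement canf q_pr defW abelP ntP cQP) => H K chH _.
exact: (satellite_chief canf FW chH q_pr).
Qed.

Hypothesis boundary : boundary_condition pi F f.

(** Otherwise take a minimal subgroup [L / C] of [G / C] outside [f p], where
    [C] is the centraliser of [H / K]. It is critical, so in [F] by the boundary
    condition, and saturation gives a supplement [M] of [C] in [L] that is in
    [F]. Then [H M] is in [F], hence acts on [H / K] as a group in [f p], and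
    this group involves [M C / C = L / C]. *)
Lemma Int_chief_satellite p (gT : finGroupType) (G H K : {group gT}) :
  prime p -> p \in pi -> chief_factor G K H -> H \subset Int F G ->
  p %| #|H / K| -> f p (G / 'C_G(H / K | 'Q))%G.
Proof.
move=> p_pr pi_p chH sHI p_dvd; apply: contrapT => nfG.
have [nKG nHG prKH _] := chief_factorP _ _ _ chH; have sKH := proper_sub prKH.
have formp := satellite_formation canf p_pr.
set C := 'C_G(H / K | 'Q)%G in nfG.
have nCG : C <| G by apply: cent_section_normal.
have [|Lb minL sLbG] := @mingroup_exists _ (fun L => `[< ~ f p L >]) (G / C)%G.
  exact/asboolP.
have [/asboolP nfL minL'] := mingroupP minL.
have FL : F Lb.
  apply: boundary; exists p; split=> //; split=> // J prJ;
    apply: contrapT => nfJ.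
  case/andP: prJ => sJL /negP[]; rewrite -(minL' J) //; exact/asboolP.
have [L defL sCL sLG] := inv_quotientS nCG sLbG.
have nCL : C <| L by apply: normalS nCG.
have FLC : F (L / C)%G.
  by apply: (formation_homg formF) FL; rewrite /= -defL homg_refl.
have [M [sML defLM FM]] := saturated_supplement formF satF nCL FLC.
have sMG := subset_trans sML sLG.
pose X := (H <*> M)%G.
have FX : F X := Int_join herF sHI sMG FM.
have sXG : X \subset G by rewrite join_subG normal_sub.
have sHX : H \subset X by apply: joing_subl.
have nHX : H <| X by apply: normalS nHG.
have nKX : K <| X by apply: normalS nKG => //; apply: subset_trans sHX.
have FXK : F (X / K)%G by apply: formation_quotient => //; apply: normal_norm.
have chR : charsimple (H / K)%G.
  by have [maxK _] := andP chH; apply: maxnormal_charsimple nHG maxK.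
have nHXK : (H / K)%G <| (X / K)%G by apply: quotient_normal.
have fXC : f p (X / 'C_X(H / K | 'Q))%G.
  apply: (formation_isog formp (quotient_cent_section_isog nKX nHX)).
  apply: (satellite_charsimple canf p_pr nHXK chR p_dvd) => H1 K1 ch1 _.
  exact: (satellite_chief canf FXK ch1 p_pr).
have nCX : X \subset 'N('C_X(H / K | 'Q)) by rewrite normal_norm
  ?cent_section_normal.
have sMX : M \subset X by apply: joing_subr.
have := hereditary_section formp (satellite_hereditary herF canf p_pr) sMX nCX
  fXC.
have nCM : M \subset 'N(C) by rewrite (subset_trans sMG) ?normal_norm.
move/(formation_quotientS formp (B := (C :&: M)%G)) => fM.
apply: nfL; apply: (formation_isog formp (_ : (M / (C :&: M))%G \isog Lb)).
  by rewrite (isog_trans (second_isog nCM)) //= defL -defLM quotientMidl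
    isog_refl.
apply: fM.
- by rewrite normsI ?normG // (subset_trans sMX).
- by rewrite normsI ?normG.
by apply/subsetP=> x /setIP[Mx /setIP[_ cx]];
  rewrite inE Mx andbT inE (subsetP sMG).
Qed.

Lemma Int_sub_hypercentre (gT : finGroupType) (G : {group gT}) :
  Int F G \subset hypercentre pi F G.
Proof.
apply: sub_hypercentre; first exact: Int_normal.
move=> H K chH sHI [p [p_pr pi_p p_dvd]].
have fp := Int_chief_satellite p_pr pi_p chH sHI p_dvd.
apply/(centralP formF herF canf chH) => q q_pr q_dvd.
have [pi_q | pi'q] := boolP (q \in pi); first exact: Int_chief_satellite.
by apply: satellite_pi' => //; apply: (satellite_sub canf p_pr).
Qed.

End Sufficiency.

(** * The equality forces the boundary condition *)

Section Necessity.

Variables (F : grp_class) (f : nat -> grp_class) (pi : nat_pred).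
Hypothesis formF : formation F.
Hypothesis satF : saturated F.
Hypothesis herF : hereditary F.
Hypothesis canf : canonical_local_satellite F f.
Hypothesis neF : exists (gT : finGroupType) (G : {group gT}), F G.
Hypothesis piF : forall p, p \in pi -> class_primes F p.
Hypothesis eqZI : forall (gT : finGroupType) (G : {group gT}),
  hypercentre pi F G :=: Int F G.

(** A normal pi'-subgroup [N] has no chief factor to be tested, so it lies in
    the hypercentre, hence in every F-maximal subgroup; and [N] has a supplement
    in [F]. *)
Lemma Int_pi'_ext (gT : finGroupType) (G N : {group gT}) :
  N <| G -> pi^'.-group N -> F (G / N)%G -> F G.
Proof.
move=> nNG p'N FGN.
have sNI : N \subset Int F G.
  rewrite -eqZI; apply: sub_hypercentre => // H K chH sHN [p [p_pr pi_p p_dvd]].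
  have := pgroupP (pgroupS sHN p'N) p p_pr (dvdn_trans p_dvd (dvdn_quotient _
    _)).
  by rewrite inE /= pi_p.
have [L [sLG defG FL]] := saturated_supplement formF satF nNG FGN.
have := Int_join herF sNI sLG FL; apply: (formation_homg formF).
have nNL : L \subset 'N(N) by rewrite (subset_trans sLG) ?normal_norm.
by rewrite /= norm_joinEr // defG homg_refl.
Qed.

Lemma eqclass_class_prod_pi' : eqclass F (class_prod (pi_groups pi^') F).
Proof.
move=> gT G; split=> [FG | p'R]; last first.
  exact: Int_pi'_ext (residual_normal formF neF G) p'R (residual_quotient formF
    neF G).
have R1 : residual F G :=: 1.
  apply/trivgP; apply: residual_sub; first exact: normal1.
  by apply: formation_quotient; rewrite ?norms1.
by rewrite /class_prod /pi_groups R1 pgroup1.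
Qed.

Lemma chief_factor_dvd p (gT : finGroupType) (G N : {group gT}) :
  prime p -> N <| G -> p %| #|N| ->
  exists H K : {group gT}, chief_factor G K H /\ p %| #|H / K|.
Proof.
move=> p_pr; have [n] := ubnP #|N|; elim: n N => // n IHn N leNn nNG p_dvd.
have ntN : N :!=: 1.
  apply: contraL p_dvd => /eqP->; rewrite cards1 dvdn1.
  by apply: contraTneq p_pr => ->.
have [K chN] := chief_factor_below nNG ntN.
have [nKG _ prKN _] := chief_factorP _ _ _ chN; have sKN := proper_sub prKN.
have [pNK | p'NK] := boolP (p %| #|N / K|); first by exists N, K.
apply: (IHn K) => //; first by rewrite (leq_trans (proper_card prKN)) // -ltnS.
have nKN : K <| N by apply: normalS nKG => //; apply: normal_sub.
move: p_dvd; rewrite -(Lagrange sKN) -card_quotient ?normal_norm //.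
by rewrite Euclid_dvdM // (negPf p'NK) orbF.
Qed.

Lemma satellite_nonempty p :
  prime p -> exists (gT : finGroupType) (G : {group gT}), f p G.
Proof.
move=> p_pr.
have [gT [G [FG p_dvd]]] : exists (gT : finGroupType) (G : {group gT}), F G /\
  p %| #|G|.
  have [/piF[_] // | pi'p] := boolP (p \in pi).
  have [hT [H0 _]] := neF.
  have [wT [P [_ [_ [_ _ abelP ntP _]]]]] := regular_module_sdprod H0 p_pr.
  have [pP _ _] := and3P abelP; exists wT, P; split.
    apply: (Int_pi'_ext (normal_refl P)).
      by apply: sub_in_pnat pP => r _; rewrite !inE => /eqP->.
    by apply: formation_trivial => //=; rewrite trivg_quotient.
  by have [] := pgroup_pdiv pP ntP.
have [H [K [chH pHK]]] := chief_factor_dvd p_pr (normal_refl G) p_dvd.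
by eexists; eexists; apply: (satellite_chief canf FG chH p_pr pHK).
Qed.

(** A nilpotent group is an iterated extension by its centre, on which it acts
    trivially, and the trivial group is in every [f q] since [F] involves all
    the primes: those outside [pi] because pi'-groups are in [F]. *)
Lemma nilpotent_sub_class : subclass nilpotent_groups F.
Proof.
move=> gT G; have [n] := ubnP #|G|; elim: n gT G => // n IHn gT G leGn nilG.
have [G1 | ntG] := eqVneq (G : {set gT}) 1; first exact: formation_trivial.
have nZG : 'Z(G)%G <| G by apply: center_normal.
apply: (satellite_normal_ext canf nZG) => [|q q_pr _].
  apply: IHn; last exact: quotient_nil.
  rewrite ltnS in leGn; apply: leq_trans leGn.
  by rewrite ltn_quotient ?center_sub //= center_nil_eq1.
apply: formation_trivial.
- exact: (satellite_formation canf q_pr).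
- exact: satellite_nonempty.
by apply: quotientS1; rewrite subsetI subxx centsC subsetIr.
Qed.

(** Let [W = P Q] where [Q] is a copy of a critical group [G], supposed outside
    [F], and [P] is the regular module. An F-maximal subgroup [U] of [W] does
    not supplement [P], as [G] is not in [F]; so [P U] meets [Q] in a proper
    subgroup, which is in [f p], and [P U] is in [F]. Thus [P] lies in every
    F-maximal subgroup, hence in the hypercentre of [W]: its chief factors are
    central, and the action on [P] puts [G] in [f p], a contradiction. *)
Lemma critical_boundary : boundary_condition pi F f.
Proof.
move=> gT G [p [p_pr pi_p [nfG critG]]]; apply: contrapT => nFG.
have formp := satellite_formation canf p_pr.
have [wT [P [Q [W [defW isoGQ abelP ntP cQP]]]]] := regular_module_sdprod G
  p_pr.
have [nPW sQW defPQ nPQ tiPQ] := sdprod_context defW.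
have [pP _ _] := and3P abelP.
have nFQ : ~ F Q by move=> FQ; apply/nFG/(formation_isog formF _ FQ);
  rewrite isog_sym.
have fproper (J : {group wT}) : J \proper Q -> f p J.
  have [g injg defG] : exists2 g : {morphism Q >-> gT}, 'injm g & g @* Q = G.
    by apply/isogP; rewrite isog_sym.
  move=> prJ; apply: (formation_isog formp (_ : (g @* J)%G \isog J)).
    by rewrite isog_sym sub_isog ?(proper_sub prJ).
  by apply: critG; rewrite /= -defG injm_proper ?(proper_sub prJ).
have sPI : P \subset Int F W.
  apply: sub_Int => U [sUW FU maxU].
  pose X := (P <*> U)%G.
  have sPX : P \subset X by apply: joing_subl.
  have sXW : X \subset W by rewrite join_subG normal_sub.
  have nPU : U \subset 'N(P) by rewrite (subset_trans sUW) ?normal_norm.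
  have defX : P * (X :&: Q) = X by rewrite setIC group_modl // defPQ;
    apply/setIidPr.
  suff FX : F X by rewrite (maxU X) ?joing_subl ?joing_subr.
  (* If [P U = W], then [G] is an image of [U]. *)
  have [sQX | prXQ] := eqVproper (subsetIr X Q).
    case: nFQ; apply: (formation_homg formF) FU.
    have : U / P \homg U by apply: quotient_homg.
    apply: homg_trans; rewrite -(quotientYidl nPU).
    have -> : P <*> U = W by rewrite -/(gval X) -defX sQX.
    by apply: isog_hom; apply: sdprod_isog defW.
  apply: (satellite_sub canf p_pr).
  have dX : P ><| (X :&: Q) = X.
    by rewrite sdprodE //;
      [rewrite (subset_trans (subsetIr _ _)) | apply/trivgP;
      rewrite -tiPQ setIS ?subsetIr].
  by apply: (satellite_sdprod canf p_pr dX pP (isog_refl _)); apply: fproper.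
have [nZW cZ] := hypercentre_normal_central pi formF herF canf W.
case: nfG; apply: (formation_isog formp (_ : Q \isog G));
  first by rewrite isog_sym.
apply: (satellite_complement canf p_pr defW abelP ntP cQP) => H K chH sHP pHK.
apply: ((centralP formF herF canf chH).1 _ p p_pr pHK); apply: cZ chH _ _.
  by rewrite eqZI (subset_trans sHP).
by exists p.
Qed.

End Necessity.

(** * The characterisation *)

Theorem theoremA (F : grp_class) (Fsat : nat -> grp_class) (pi : nat_pred) :
  formation F -> saturated F -> hereditary F ->
  ~ eqclass F identity_groups -> ~ eqclass F all_groups ->
  canonical_local_satellite F Fsat ->
  (exists p, p \in pi) -> (forall p, p \in pi -> class_primes F p) ->
  (forall (gT : finGroupType) (G : {group gT}),
     hypercentre pi F G :=: Int F G)
  <->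
  [/\ subclass nilpotent_groups F,
      eqclass F (class_prod (pi_groups pi^') F)
    & boundary_condition pi F Fsat].
Proof.
move=> formF satF herF _ _ canf [p0 pi_p0] piF.
have neF : exists (gT : finGroupType) (G : {group gT}), F gT G.
  by have [_ [gT [G [FG _]]]] := piF _ pi_p0; exists gT, G.
split=> [eqZI | [_ prodF bdF] gT G].
  split; first exact: (nilpotent_sub_class formF satF herF canf neF piF eqZI).
    exact: (eqclass_class_prod_pi' formF satF herF neF eqZI).
  exact: (critical_boundary formF herF canf eqZI).
have pi'_ext := class_prod_pi'_ext (fun hT (H : {group hT}) => (prodF hT H).2).
apply/eqP; rewrite eqEsubset (hypercentre_sub_Int formF herF canf pi'_ext) /=.
exact: (Int_sub_hypercentre formF satF herF canf neF pi'_ext bdF).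
Qed.
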